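(* Let $\rho>0$, let $L\ge1$ be an integer, $\sigma_E^2=\frac{1}{1+\rho L}$, and $y>0$. Suppose a single access point transmits to two devices at nominal SNR $\rho$: let $\hat h_1,\hat h_2$ be independent $\mathcal{CN}(0,1-\sigma_E^2)$ random variables and $Y_d=\frac{1}{\log_2(1+\rho|\hat h_d|^2)}$ for $d=1,2$. Then the probability of time underflow with respect to the deadline $y$ is $$\mathbb{P}[Y_1+Y_2\le y]=\frac{1}{\rho(1-\sigma_E^2)}\int_{2^{1/y}}^{\infty}\exp\left(-\frac{v+v^{\frac{1}{y\log_2 v-1}}-2}{\rho(1-\sigma_E^2)}\right)dv,$$ and it satisfies $$\exp\left(-2\,\frac{2^{2/y}-1}{\rho(1-\sigma_E^2)}\right)\le\mathbb{P}[Y_1+Y_2\le y]\le\exp\left(-2\,\frac{2^{1/y}-1}{\rho(1-\sigma_E^2)}\right).$$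
   Context: $\mathcal{CN}(0,s)$ denotes the circularly symmetric complex Gaussian distribution with mean $0$ and variance $s$ (so $X\sim\mathcal{CN}(0,s)$ has $\mathbb{E}|X|^2=s$). $\hat h_d$ is the MMSE channel estimate for device $d$ from $L$ pilots. With bandwidth $W$, the rate selected for device $d$ is $R_d=W\log_2(1+\rho|\hat h_d|^2)$, and $Y_d=W/R_d$ is the time needed to transmit one bit in one Hertz. Time underflow with respect to a time budget $y$ is the event that the sum of the $Y_d$ is at most $y$. *)

(* Defs.v *)
From HB Require Import structures.
From mathcomp Require Import all_boot all_order all_algebra.
From mathcomp Require Import complex.
From mathcomp Require Import all_classical all_reals all_analysis.

Set Implicit Arguments.
Unset Strict Implicit.
Unset Printing Implicit Defensive.

Import Order.TTheory GRing.Theory Num.Theory.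
Import numFieldNormedType.Exports.

Local Open Scope classical_set_scope.
Local Open Scope ring_scope.

(* The Borel sigma-algebra of C, obtained from that of R^2 through the
   bijection z |-> (Re z, Im z). *)
Section complex_measurable.
Variable R : realType.

Definition complex_pair (z : R[i]) : R * R := (complex.Re z, complex.Im z).

HB.instance Definition _ := isPointed.Build R[i] (Complex 0 0).

Definition complex_display : measure_display := preimage_display complex_pair.

Definition complex_measurable : set (set R[i]) :=
  g_sigma_algebra_preimage complex_pair.

Let cm0 : complex_measurable set0.
Proof. exact: (@measurable0 _ (g_sigma_algebra_preimageType complex_pair)). Qed.

Let cmC A : complex_measurable A -> complex_measurable (~` A).
Proof. exact: (@measurableC _ (g_sigma_algebra_preimageType complex_pair)). Qed.

Let cmU (F : (set R[i])^nat) :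
  (forall i, complex_measurable (F i)) -> complex_measurable (\bigcup_i F i).
Proof.
exact: (@bigcupT_measurable _ (g_sigma_algebra_preimageType complex_pair)).
Qed.

HB.instance Definition _ :=
  isMeasurable.Build complex_display R[i] cm0 cmC cmU.

End complex_measurable.

Section circular_gaussian.
Variable R : realType.

(* [normal_prob] is parameterized by the standard deviation: the real and
   imaginary parts are independent centred Gaussians of variance s / 2 each.
   This is CN(0, s) for s > 0 only, since [normal_prob 0 0] is not the point
   mass at 0. *)
Definition complex_normal_prob (s : R) : set R[i] -> \bar R :=
  pushforward
    (normal_prob 0 (Num.sqrt (s / 2)) \x normal_prob 0 (Num.sqrt (s / 2)))%E
    (fun p : R * R => Complex p.1 p.2).

(* Laws are compared on measurable sets only, as set functions such as
   [distribution P Z] are defined on all subsets. *)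
Definition circular_gaussian d (T : measurableType d) (P : probability T R)
    (s : R) (Z : {RV P >-> R[i]}) : Prop :=
  forall A : set R[i], measurable A ->
    distribution P Z A = complex_normal_prob s A.

End circular_gaussian.

Definition independent_RV d (T : measurableType d) (R : realType)
    (P : probability T R) d1 (T1 : measurableType d1) d2
    (T2 : measurableType d2) (X : {RV P >-> T1}) (Y : {RV P >-> T2}) : Prop :=
  forall (A : set T1) (B : set T2), measurable A -> measurable B ->
    P (X @^-1` A `&` Y @^-1` B) = (P (X @^-1` A) * P (Y @^-1` B))%E.

Definition log2 (R : realType) (x : R) : R := ln x / ln 2.

(* Y = 1 / log2 (1 + rho |h|^2) is computed in the extended reals, where
   0^-1 = +oo: no bit is ever transmitted over a channel with h = 0. *)
Definition bit_time (R : realType) (rho : R) (h : R[i]) : \bar R :=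
  ((log2 (1 + rho * ComplexField.Normc.normc h ^+ 2))%:E^-1)%E.

(* Main.v *)
(** The squared modulus of a CN(0, s) variable is exponential of rate 1/s: its
    Gaussian density depends on the squared norm only, and the squared norm of
    the plane pushes Lebesgue measure forward to a multiple of Lebesgue measure
    on the half-line.  Hence V = 1 + rho |h|^2 is a shifted exponential, and
    with v the value of V_1, underflow means
      v > 2^(1/y)  and  V_2 >= v^(1 / (y log2 v - 1)).
    Conditioning on V_1 gives the integral.  For the bounds, the underflow event
    contains the event that both Y_d <= y/2, and is contained in the event that
    both Y_d <= y. *)
From HB Require Import structures.
Require Import Defs.
From mathcomp Require Import all_boot all_order all_algebra.
From mathcomp Require Import complex ring lra.
From mathcomp Require Import all_classical all_reals all_analysis.
From mathcomp Require Import measurable_realfun.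

Import Order.TTheory GRing.Theory Num.Theory.
Import numFieldNormedType.Exports.

Local Open Scope classical_set_scope.
Local Open Scope ring_scope.

Set Implicit Arguments.
Unset Strict Implicit.

(** * Densities and scaling of Lebesgue measure *)

(** The formula on sets makes [nu] absolutely continuous with respect to [mu]. Then [f] and the
    Radon-Nikodym derivative have the same integral over every measurable set, so they agree almost
    everywhere and may be exchanged under the integral. *)
Lemma ge0_integral_density (R : realType) (d : measure_display)
    (T : measurableType d) (nu : {finite_measure set T -> \bar R})
    (mu : {sigma_finite_measure set T -> \bar R}) (f g : T -> \bar R) :
  measurable_fun setT f -> (forall x, 0 <= f x)%E ->
  (forall A, measurable A -> nu A = \int[mu]_(x in A) f x)%E ->
  measurable_fun setT g -> (forall x, 0 <= g x)%E ->
  (\int[nu]_x g x = \int[mu]_x (g x * f x))%E.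
Proof.
move=> mf f0 nuE mg g0.
have numu : nu `<< mu.
  apply/null_content_dominatesP => A mA muA0.
  by rewrite nuE//; apply: null_set_integral => //; exact: measurable_funTS.
rewrite -(Radon_Nikodym_SigmaFinite.change_of_variables numu g0 measurableT mg).
have mRN := measurable_int _ (Radon_Nikodym_SigmaFinite.f_integrable numu).
apply: ae_eq_integral => //; [exact: emeasurable_funM|exact: emeasurable_funM|].
apply: ae_eqe_mul2l; apply: integral_ae_eq => //.
  exact: Radon_Nikodym_SigmaFinite.f_integrable.
by move=> E _ mE; rewrite -nuE// -Radon_Nikodym_SigmaFinite.f_integral.
Qed.

(* The library's canonical measure on a pushforward depends on a measurability
   proof that unification cannot find, so it has to be named. *)
Definition pushforward_measure d1 d2 (T1 : measurableType d1)
    (T2 : measurableType d2) (R : realType) (m : {measure set T1 -> \bar R})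
    (f : T1 -> T2) (mf : measurable_fun setT f) : {measure set T2 -> \bar R} :=
  measure_function_pushforward__canonical__measure_function_Measure m mf.

(** As a function of [A] the left side is a measure; it gives each interval []b, c]] its length, and
    Lebesgue measure is the only measure that does. *)
Lemma lebesgue_measure_affine (R : realType) (a r : R) (A : set R) :
  0 < r -> measurable A ->
  (r%:E * lebesgue_measure ((fun x : R => a + r * x)%R @^-1` A) =
   lebesgue_measure A)%E.
Proof.
move=> r0 mA.
have mF : measurable_fun [set: measurableTypeR R]
    (fun x => a + r * x : measurableTypeR R).
  apply: measurable_funD => //; exact: measurable_funM.
pose m : {measure set (measurableTypeR R) -> \bar R} :=
  mscale (NngNum (ltW r0)) (pushforward_measure (@lebesgue_measure R) mF).
rewrite [RHS](@lebesgue_measure_unique _ m)//= => _ [[b c] _ <-].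
rewrite /m /mscale/= /pushforward.
have -> : (fun x : R => a + r * x) @^-1` `]b, c]%classic =
    `](b - a) / r, (c - a) / r]%classic.
  apply/seteqP; split => x /=; rewrite !in_itv/= ltr_pdivrMr// ler_pdivlMr//;
    by rewrite ltrBlDl lerBrDl mulrC.
rewrite !lebesgue_measure_itv/= !lte_fin ltr_pM2r ?invr_gt0// ltrD2r.
case: ifPn => _; last by rewrite mule0.
by rewrite -EFinD -EFinM; congr EFin; field; rewrite gt_eqF.
Qed.

(** Uniqueness of the product measure reduces this to rectangles, where each side contributes one
    factor [r]. *)
Lemma lebesgue_measure2_scale (R : realType) (r : R) (A : set (R * R)) :
  0 < r -> measurable A ->
  ((r ^+ 2)%:E * (lebesgue_measure \x lebesgue_measure)
     ((fun p : R * R => (r * p.1, r * p.2)%R) @^-1` A) =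
   (lebesgue_measure \x lebesgue_measure) A)%E.
Proof.
move=> r0 mA.
have mF : measurable_fun [set: measurableTypeR R * measurableTypeR R]
    (fun p => (r * p.1, r * p.2)
       : measurableTypeR R * measurableTypeR R).
  by apply/measurable_fun_pair; exact: measurable_funM.
pose m : {measure set (measurableTypeR R * measurableTypeR R) -> \bar R} :=
  mscale (NngNum (sqr_ge0 r))
    (pushforward_measure (@lebesgue_measure R \x @lebesgue_measure R)%E mF).
rewrite [RHS](@product_measure_unique _ _ _ _ _ _ _ m)//= => B C mB mC.
have affE D : measurable D -> (lebesgue_measure D =
    r%:E * lebesgue_measure ((fun x : R => r * x)%R @^-1` D))%E.
  move=> mD; rewrite -(lebesgue_measure_affine 0 r0 mD).
  by congr (_ * lebesgue_measure _)%E; apply/seteqP; split => x /=; rewrite add0r.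
have mpre D : measurable D ->
    measurable ((fun x : measurableTypeR R => r * x : measurableTypeR R) @^-1` D).
  by move=> mD; rewrite -[X in measurable X]setTI; apply: measurable_funM.
rewrite /m /mscale/= /pushforward.
rewrite -[(_ @^-1` (B `*` C))]/
  (((fun x => r * x) @^-1` B) `*` ((fun x => r * x) @^-1` C)).
rewrite product_measure1E//; [|exact: mpre|exact: mpre].
by rewrite (affE B)// (affE C)// muleACA -EFinM.
Qed.

(** * Lebesgue measure of the plane seen through the squared norm *)

Definition sqnorm (R : realType) (p : R * R) : R := p.1 ^+ 2 + p.2 ^+ 2.

Lemma measurable_sqnorm (R : realType) :
  measurable_fun [set: R * R] (@sqnorm R).
Proof. by apply: measurable_funD; apply: measurable_funX. Qed.

Lemma sqnorm_ge0 (R : realType) (p : R * R) : 0 <= sqnorm p.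
Proof. by rewrite addr_ge0// sqr_ge0. Qed.

(* Scaling makes the area of the disc of squared radius [x] proportional to
   [x], so under Lebesgue measure on the plane the squared norm has a uniform
   law on the half-line; the constant [K], which is [pi], is never needed. *)
Lemma lebesgue_measure2_sqnorm (R : realType) :
  exists2 K : R, 0 <= K & forall A : set R, measurable A ->
    ((lebesgue_measure \x lebesgue_measure)
       (@sqnorm R @^-1` A) =
     K%:E * lebesgue_measure (A `&` `[0%R, +oo[))%E.
Proof.
pose l2 := (@lebesgue_measure R \x @lebesgue_measure R)%E.
pose q := @sqnorm R.
have mq : measurable_fun [set: measurableTypeR R * measurableTypeR R]
  (q : _ -> measurableTypeR R) by exact: measurable_sqnorm.
have mpre (D : set R) : measurable D -> measurable (q @^-1` D).
  by move=> mD; rewrite -[X in measurable X]setTI; exact: mq.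
pose disc : set (R * R) := q @^-1` `]-oo, 1[.
have mdisc : measurable disc by exact: mpre.
have disc_fin : (l2 disc < +oo)%E.
  pose box : set R := `[-1, 1]%classic.
  apply: (@le_lt_trans _ _ (l2 (box `*` box))).
    apply: le_measure; rewrite ?inE//.
      by apply: measurableX; exact: measurable_itv.
    move=> [x y]; rewrite /disc /q /sqnorm /box/= !in_itv/= => xy.
    have := sqr_ge0 x; have := sqr_ge0 y => y0 x0.
    by split; apply/andP; split; nra.
  rewrite /l2 product_measure1E; [|exact: measurable_itv|exact: measurable_itv].
  have box_fin : (lebesgue_measure box < +oo)%E.
    by rewrite /box lebesgue_measure_itv/=; case: ifP => _; rewrite -?EFinD ltry.
  by apply: lte_mul_pinfty => //; rewrite ge0_fin_numE.
(* The constant is the area of the open unit disc; by [disc_fin] nothing is lost in [fine]. *)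
exists (fine (l2 disc)) => [|A mA]; first by rewrite fine_ge0.
pose K := NngNum (fine_ge0 (measure_ge0 l2 disc)).
have mI : measurable (`[0, +oo[%classic : set (measurableTypeR R)) by [].
pose m1 : {measure set (measurableTypeR R) -> \bar R} :=
  pushforward_measure (@lebesgue_measure R \x @lebesgue_measure R)%E mq.
pose m2 : {measure set (measurableTypeR R) -> \bar R} :=
  mscale K (mrestr (@lebesgue_measure R) mI).
(* For positive [x] the preimage is the unit disc scaled by the square root of [x]; otherwise it is
   empty. *)
have m1E x : m1 `]-oo, x[%classic =
    (if (0 < x)%R then x%:E * l2 disc else 0)%E.
  case: ifPn => x0; last first.
    rewrite -[LHS]/(l2 (q @^-1` `]-oo, x[)) (_ : _ @^-1` _ = set0) ?measure0//.
    apply/seteqP; split => // -[a b]; rewrite /q /sqnorm/= in_itv/= => ab.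
    have := sqr_ge0 a; have := sqr_ge0 b; move: x0; rewrite -leNgt; lra.
  have rx0 : 0 < Num.sqrt x by rewrite sqrtr_gt0.
  rewrite -[LHS]/(l2 (q @^-1` `]-oo, x[)).
  have := lebesgue_measure2_scale rx0 (mpre `]-oo, x[%classic _).
  rewrite sqr_sqrtr ?(ltW x0)// => /(_ (measurable_itv _))/esym scaleE.
  apply: etrans scaleE _; congr (_ * l2 _)%E; apply/seteqP.
  by split => -[a b]; rewrite /disc /q /sqnorm/= !in_itv/= !exprMn sqr_sqrtr ?(ltW x0)//;
    rewrite -mulrDr -{2}[x]mulr1 ltr_pM2l.
have KE : (K%:num%:E)%E = l2 disc by rewrite /= fineK// ge0_fin_numE.
rewrite -[LHS]/(m1 A) -[RHS]/(m2 A).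
(* The open rays form a generating pi-system, and those ending at a natural number exhaust the line
   with finite measure. *)
apply: (@measure_unique _ R (measurableTypeR R) (@RGenInftyO.G R)
  (fun n => `]-oo, n%:R[%classic) _ _ _ _ m1 m2 _ _ A mA).
- exact: RGenInftyO.measurableE.
- move=> _ _ [x ->] [z ->]; exists (Num.min x z).
  by apply/seteqP; split => t /=; rewrite !in_itv/= lt_min => /andP.
- by move=> n; exists n%:R.
- apply/seteqP; split => // x _; exists (Num.truncn x).+1 => //=.
  by rewrite in_itv/= truncnS_gt.
- move=> _ [x ->]; rewrite m1E.
  rewrite -[RHS]/((K%:num)%:E * lebesgue_measure (`]-oo, x[ `&` `[0%R, +oo[))%E KE.
  case: ifPn => x0.
    rewrite (_ : _ `&` _ = `[0, x[%classic); last first.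
      apply/seteqP; split => t /=; rewrite !in_itv/= andbT.
        by move=> [-> ->].
      by move=> /andP[-> ->].
    by rewrite lebesgue_measure_itv/= lte_fin x0 oppr0 adde0 muleC.
  rewrite (_ : _ `&` _ = set0) ?measure0 ?mule0//.
  apply/seteqP; split => // t /=; rewrite !in_itv/= andbT => -[].
  by move: x0; rewrite -leNgt; lra.
- move=> n; rewrite m1E; case: ifPn => // _.
  by rewrite lte_mul_pinfty ?lee_fin.
Qed.

Lemma integral2_sqnorm (R : realType) :
  exists2 K : R, 0 <= K & forall h : R -> \bar R, measurable_fun setT h ->
    (forall t, 0 <= h t)%E ->
    (\int[lebesgue_measure \x lebesgue_measure]_p h (sqnorm p) =
     K%:E * \int[lebesgue_measure]_(t in `[0%R, +oo[) h t)%E.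
Proof.
have [K K0 KE] := lebesgue_measure2_sqnorm R; exists K => // h mh h0.
pose q := @sqnorm R.
have mq : measurable_fun [set: measurableTypeR R * measurableTypeR R]
  (q : _ -> measurableTypeR R) by exact: measurable_sqnorm.
have mI : measurable (`[0, +oo[%classic : set (measurableTypeR R)) by [].
pose m1 : {measure set (measurableTypeR R) -> \bar R} :=
  pushforward_measure (@lebesgue_measure R \x @lebesgue_measure R)%E mq.
pose m2 : {measure set (measurableTypeR R) -> \bar R} :=
  mscale (NngNum K0) (@lebesgue_measure R).
have qT : q @^-1` `[0, +oo[ = setT.
  apply/seteqP; split => // p _; rewrite /= in_itv/= andbT.
  exact: sqnorm_ge0.
transitivity (\int[m1]_(t in `[0%R, +oo[) h t)%E.
  have := @ge0_integral_pushforward _ _ _ _ _ _ mq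
    (@lebesgue_measure R \x @lebesgue_measure R)%E _ h mI (measurable_funTS mh)
    (fun t _ => h0 t).
  by rewrite qT => /esym.
transitivity (\int[m2]_(t in `[0%R, +oo[) h t)%E.
  apply: eq_measure_integral => A mA A0.
  by rewrite [LHS](KE A mA) setIidl.
by rewrite ge0_integral_mscale//; exact: measurable_funTS.
Qed.

(** * From two Gaussian coordinates to the exponential law *)

(** The Gaussian density is inserted in the outer variable by [ge0_integral_density] and in the
    inner one by definition; Tonelli joins the two integrals. *)
Lemma normal_prob2E (R : realType) (sigma : R) (A : set (R * R)) :
  measurable A ->
  ((normal_prob 0 sigma \x normal_prob 0 sigma) A =
   \int[lebesgue_measure \x lebesgue_measure]_p
     (normal_pdf 0 sigma p.1 * normal_pdf 0 sigma p.2 * \1_A p)%:E)%E.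
Proof.
move=> mA; rewrite [LHS]/product_measure1.
have mpdf := @measurable_normal_pdf R 0 sigma.
have pdf0 := @normal_pdf_ge0 R 0 sigma.
rewrite (@ge0_integral_density _ _ _ _ (@lebesgue_measure R)
  (fun x => (normal_pdf 0 sigma x)%:E))//; last 2 first.
- exact/measurable_EFinP.
- exact: measurable_fun_xsection.
rewrite fubini_tonelli1//; last 2 first.
- apply/measurable_EFinP; apply: measurable_funM; last exact: measurable_indic.
  by apply: measurable_funM; apply: measurableT_comp.
- by move=> p; rewrite lee_fin !mulr_ge0.
apply: eq_integral => x _; rewrite /fubini_F/=.
under [RHS]eq_integral do rewrite -mulrA EFinM.
rewrite ge0_integralZl//; last 3 first.
- apply/measurable_EFinP; apply: measurable_funM => //.
  apply: (measurableT_comp (measurable_indic _)) => //.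
- by move=> z _; rewrite lee_fin mulr_ge0.
- by rewrite lee_fin.
rewrite muleC; congr (_ * _)%E.
rewrite /normal_prob [LHS]integral_mkcond; apply: eq_integral => z _ /=.
rewrite patchE indicE mem_xsection.
by case: ifPn => _; rewrite ?mulr1 ?mulr0.
Qed.

Lemma normal_prob2_sqnorm (R : realType) (s : R) (A : set R) :
  0 < s -> measurable A ->
  ((normal_prob 0 (Num.sqrt (s / 2)) \x normal_prob 0 (Num.sqrt (s / 2)))
     (@sqnorm R @^-1` A) = exponential_prob s^-1 A)%E.
Proof.
move=> s0; set sigma := Num.sqrt (s / 2); set N := (normal_prob 0 sigma \x _)%E.
have sV0 : 0 < s^-1 by rewrite invr_gt0.
have sigma0 : sigma != 0 by rewrite gt_eqF// sqrtr_gt0 divr_gt0.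
have sigma2 : sigma ^+ 2 *+ 2 = s.
  by rewrite sqr_sqrtr ?divr_ge0 ?ltW// mulr2n; lra.
have [K K0 KE] := integral2_sqnorm R.
(* The factor [s] cancels the rate [s^-1] in front of the exponential density, which leaves the
   squared Gaussian peak. *)
pose C := normal_peak sigma ^+ 2 * s.
have C0 : 0 <= C by rewrite mulr_ge0 ?sqr_ge0 ?ltW.
(* It is enough to have proportionality: both laws have total mass 1, so [B = setT] forces
   [K * C = 1], without the value of either constant. *)
suff NE B : measurable B -> N (@sqnorm R @^-1` B) =
    ((K * C)%:E * exponential_prob s^-1 B)%E.
  have NT : N [set: R * R] = 1%E.
    rewrite -setXTT /N product_measure1E// -[RHS]mule1.
    by congr (_ * _)%E; exact: probability_setT.
  have KC1 : (K * C)%:E = 1%E :> \bar R.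
    by have := NE setT measurableT;
      rewrite preimage_setT NT /exponential_prob integral_exponential_pdf// mule1.
  by move=> mA; rewrite NE// KC1 mul1e.
move=> mB.
have mq : measurable_fun [set: measurableTypeR R * measurableTypeR R]
  (@sqnorm R : _ -> measurableTypeR R) by exact: measurable_sqnorm.
pose h t := (C * exponential_pdf s^-1 t * \1_B t)%:E : \bar R.
have mpdf := measurable_exponential_pdf s^-1.
have pdf0 x : 0 <= exponential_pdf s^-1 x.
  by apply: exponential_pdf_ge0; exact: ltW.
rewrite /N normal_prob2E; last first.
  by rewrite -[X in measurable X]setTI; exact: mq.
transitivity (\int[lebesgue_measure \x lebesgue_measure]_p h (sqnorm p))%E.
  apply: eq_integral => -[a b] _; rewrite /h/=; congr (_ * _)%:E.
  rewrite exponential_pdfE ?sqnorm_ge0// normal_pdfE// /normal_fun sigma2 !subr0.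
  (* Since [sigma ^+ 2 *+ 2 = s], the two Gaussian exponents add up to minus the squared norm over
     [s]. *)
  rewrite mulrACA -expRD -expr2 /C -mulrA (mulrA s) divff ?gt_eqF// mul1r.
  by congr (_ * expR _); rewrite /sqnorm/=; ring.
apply: etrans (KE h _ _) _.
- apply/measurable_EFinP; apply: measurable_funM; last exact: measurable_indic.
  by apply: measurable_funM.
- by move=> t; rewrite lee_fin; apply: mulr_ge0 => //; exact: mulr_ge0.
rewrite EFinM -muleA; congr (_ * _)%E.
rewrite /exponential_prob -ge0_integralZl//; last 2 first.
- by apply/measurable_EFinP; exact: measurable_funTS.
- by move=> t _; rewrite lee_fin.
rewrite [LHS]integral_mkcond [RHS]integral_mkcond; apply: eq_integral => t _.
rewrite !patchE /h indicE /exponential_pdf patchE.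
by case: (t \in `[0, +oo[%classic); case: (t \in B);
  rewrite ?mulr1 ?mulr0 ?mule0 ?EFinM.
Qed.

Lemma ge0_integral_affine (R : realType) (a r : R) (g : R -> \bar R) :
  0 < r -> measurable_fun setT g -> (forall x, 0 <= g x)%E ->
  (\int[lebesgue_measure]_x g x =
   r%:E * \int[lebesgue_measure]_x g (a + r * x)%R)%E.
Proof.
move=> r0 mg g0.
have mF : measurable_fun [set: measurableTypeR R]
    (fun x => a + r * x : measurableTypeR R).
  by apply: measurable_funD => //; exact: measurable_funM.
pose m : {measure set (measurableTypeR R) -> \bar R} :=
  mscale (NngNum (ltW r0)) (pushforward_measure (@lebesgue_measure R) mF).
transitivity (\int[m]_x g x)%E.
  apply: eq_measure_integral => A mA _.
  by rewrite -[LHS](lebesgue_measure_affine a r0 mA).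
rewrite ge0_integral_mscale//; congr (_ * _)%E.
exact: (ge0_integral_pushforward mF).
Qed.

Lemma exponential_prob_itvcy (R : realType) (rate x : R) :
  0 < rate -> 0 <= x ->
  exponential_prob rate `[x, +oo[ = (expR (- (rate * x)))%:E.
Proof.
move=> rate0 x0; rewrite /exponential_prob.
pose f t := rate * expR (- rate * t).
have dF (t : R) : is_derive t 1 (fun t => - expR (- rate * t)) (f t).
  by apply: is_derive_eq; rewrite /f /GRing.scale/=; ring.
have cf : continuous f.
  move=> t; apply: cvgM; first exact: cvg_cst.
  apply: (cvg_comp _ expR); last exact: continuous_expR.
  by apply: cvgM; [exact: cvg_cst|exact: cvg_id].
transitivity (\int[lebesgue_measure]_(t in `[x, +oo[) (f t)%:E)%E.
  apply: eq_integral => t; rewrite inE/= in_itv/= andbT => xt.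
  by rewrite exponential_pdfE// (le_trans x0).
rewrite (@ge0_continuous_FTC2y _ f (fun t => - expR (- rate * t)) x 0).
- by rewrite -EFinB; congr EFin; rewrite sub0r opprK mulNr.
- by move=> t _; rewrite mulr_ge0 ?expR_ge0 ?ltW.
- exact: continuous_subspaceT.
- rewrite -oppr0; apply: cvgN.
  rewrite (_ : (fun x => expR (- rate * x)) =
               (fun z => expR (- z)) \o (fun z => rate * z)); last first.
    by apply/funext => z; rewrite /= mulNr.
  by apply: (@cvg_comp _ _ _ _ _ _ (pinfty_nbhs R));
    [exact: gt0_cvgMry|exact: cvgr_expR].
- by move=> t _; apply: ex_derive.
- apply/cvg_at_right_filter; apply: cvgN.
  apply: (cvg_comp _ expR); last exact: continuous_expR.
  by apply: cvgM; [exact: cvg_cst|exact: cvg_id].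
- by move=> t _; rewrite derive1E derive_val.
Qed.

(** * Squared modulus of a circular Gaussian variable *)

Lemma sqr_normcE (R : realType) (z : R[i]) :
  ComplexField.Normc.normc z ^+ 2 = sqnorm (complex_pair z).
Proof. by case: z => a b; rewrite sqr_sqrtr// addr_ge0// sqr_ge0. Qed.

Lemma measurable_complex_pair (R : realType) :
  measurable_fun setT (@complex_pair R).
Proof. by move=> _ Y mY; exists Y. Qed.

Lemma measurable_sqr_normc (R : realType) :
  measurable_fun [set: R[i]] (fun z => ComplexField.Normc.normc z ^+ 2).
Proof.
under eq_fun do rewrite sqr_normcE.
apply: measurableT_comp; first exact: measurable_sqnorm.
exact: measurable_complex_pair.
Qed.

Lemma circular_gaussian_sqr_normc (R : realType) (d : measure_display)
    (T : measurableType d) (P : probability T R) (s : R)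
    (h : {RV P >-> R[i]}) (A : set R) :
  0 < s -> circular_gaussian s h -> measurable A ->
  P ((fun w => ComplexField.Normc.normc (h w) ^+ 2) @^-1` A) =
  exponential_prob s^-1 A.
Proof.
move=> s0 hP mA; rewrite -normal_prob2_sqnorm//.
have mB : measurable ((fun z : R[i] => ComplexField.Normc.normc z ^+ 2) @^-1` A).
  by rewrite -[X in measurable X]setTI; exact: measurable_sqr_normc.
apply: etrans (hP _ mB) _; rewrite /complex_normal_prob /pushforward.
congr (product_measure1 _ _ _); apply/seteqP.
by split => -[a b]; rewrite /= sqr_sqrtr// addr_ge0// sqr_ge0.
Qed.

(** * Base-2 logarithms and the underflow region *)

Lemma measurable_log2 (R : realType) : measurable_fun setT (@log2 R).
Proof. by apply: measurable_funM => //; exact: measurable_ln. Qed.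

Lemma ln2_gt0 (R : realType) : 0 < ln 2 :> R.
Proof. by rewrite ln_gt0// ltr1n. Qed.

Lemma log2_ge (R : realType) (t u : R) : 0 < t ->
  (t <= log2 u) = (2 `^ t <= u).
Proof.
move=> t0; rewrite /log2 ler_pdivlMr ?ln2_gt0// /powR pnatr_eq0/=.
(* For [u <= 0] the logarithm has the default value 0; as [t] is positive, both sides are then
   false. *)
have [u0|u0] := leP u 0.
  rewrite (ln0 u0); apply/idP/idP => uu.
    by move: uu; rewrite leNgt mulr_gt0 ?ln2_gt0.
  by have := expR_gt0 (t * ln 2); rewrite ltNge (le_trans uu).
by rewrite -[in RHS](lnK u0) ler_expR.
Qed.

(** A zero rate has inverse [+oo], which no finite deadline [y] can bound; for positive rates the
    denominators are cleared. *)
Lemma inve_sum_le (R : realType) (u v y : R) : 0 <= u -> 0 <= v ->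
  ((u%:E^-1 + v%:E^-1 <= y%:E)%E) = [&& 0 < u, 0 < v & u + v <= y * (u * v)].
Proof.
move=> u0 v0; rewrite !inver.
case: eqVneq => [->|un0].
  rewrite ltxx/=; case: eqVneq => _; by rewrite addye ?leye_eq.
case: eqVneq => [->|vn0].
  by rewrite ltxx andbF/= addey ?leye_eq.
have up : 0 < u by rewrite lt_neqAle eq_sym un0.
have vp : 0 < v by rewrite lt_neqAle eq_sym vn0.
rewrite up vp/= -EFinD lee_fin.
have -> : u^-1 + v^-1 = (u + v) / (u * v) by field; rewrite un0 vn0.
by rewrite ler_pdivrMr// mulr_gt0.
Qed.

(** The coordinates stand for the two squared moduli. The condition has the form given by
    [inve_sum_le], so only real-valued functions occur. *)
Definition underflow_region (R : realType) (rho y : R) : set (R * R) :=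
  [set p | [&& 0 < log2 (1 + rho * p.1), 0 < log2 (1 + rho * p.2) &
    log2 (1 + rho * p.1) + log2 (1 + rho * p.2) <=
      y * (log2 (1 + rho * p.1) * log2 (1 + rho * p.2))]].

Lemma measurable_underflow_region (R : realType) (rho y : R) :
  measurable (underflow_region rho y).
Proof.
have mlog : measurable_fun [set: R] (fun x => log2 (1 + rho * x)).
  apply: (measurableT_comp (@measurable_log2 R)).
  by apply: measurable_funD => //; exact: measurable_funM.
have m1 := measurableT_comp mlog (@measurable_fst _ _ R R).
have m2 := measurableT_comp mlog (@measurable_snd _ _ R R).
rewrite -[underflow_region _ _]setTI; apply: measurable_and.
- exact: measurable_fun_ltr.
- apply: measurable_and; first exact: measurable_fun_ltr.
  apply: measurable_fun_ler; first exact: measurable_funD.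
  by apply: measurable_funM => //; exact: measurable_funM.
- exact: measurableT.
- by [].
Qed.

Lemma log2_ge0 (R : realType) (u : R) : 1 <= u -> 0 <= log2 u.
Proof. by move=> u1; rewrite divr_ge0 ?ln_ge0// ?ler1n. Qed.

Lemma powR_log2 (R : realType) (u : R) : 0 < u -> 2 `^ log2 u = u.
Proof.
move=> u0; rewrite /powR pnatr_eq0/= /log2 divfK ?lnK//.
by rewrite gt_eqF// ln2_gt0.
Qed.

Lemma log2_gt (R : realType) (t u : R) : 0 < u ->
  (t < log2 u) = (2 `^ t < u).
Proof.
move=> u0; rewrite /log2 ltr_pdivlMr ?ln2_gt0// /powR pnatr_eq0/=.
by rewrite -[in RHS](lnK u0) ltr_expR.
Qed.

(** With [w = log2 v] and [l] the other logarithm, the condition reads [w <= l * (y * w - 1)]. If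
    [y * w > 1], it is a lower bound on [l], hence a half-line. If [y * w <= 1], then
    [y * w * l <= l < w + l] and nothing remains. *)
Lemma xsection_underflow_region (R : realType) (rho y x : R) :
  0 < rho -> 0 < y -> 0 <= x ->
  xsection (underflow_region rho y) x =
  if 2 `^ (1 / y) < 1 + rho * x then
    `[((1 + rho * x) `^ (1 / (y * log2 (1 + rho * x) - 1)) - 1) / rho, +oo[%classic
  else set0.
Proof.
move=> rho0 y0 x0; set v := 1 + rho * x.
have v1 : 1 <= v by rewrite lerDl mulr_ge0// ltW.
have v0 : 0 < v by apply: lt_le_trans v1.
rewrite -log2_gt//; case: ifPn => [vy|].
  have w0 : 0 < log2 v by apply: lt_trans vy; rewrite divr_gt0.
  have yw : 0 < y * log2 v - 1 by rewrite subr_gt0 mulrC -ltr_pdivrMr.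
  have t0 : 0 < log2 v * (1 / (y * log2 v - 1)) by rewrite mulr_gt0// divr_gt0.
  have sectE l : (log2 v * (1 / (y * log2 v - 1)) <= l) =
      (log2 v + l <= y * (log2 v * l)).
    rewrite div1r ler_pdivrMr// mulrBr mulr1 lerBrDr.
    by congr (_ <= _); ring.
  have powE : v `^ (1 / (y * log2 v - 1)) =
      2 `^ (log2 v * (1 / (y * log2 v - 1))).
    by rewrite powRrM powR_log2.
  apply/seteqP; split => z; rewrite /xsection/= inE /underflow_region/= -/v w0/=
    in_itv/= andbT ler_pdivrMr// lerBlDl (mulrC z) powE -log2_ge// sectE.
    by case/andP.
  (* The lower bound on the second logarithm is positive, so its positivity comes for free. *)
  move=> lz; rewrite lz andbT; apply: lt_le_trans t0 _; by rewrite sectE.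
rewrite -leNgt => wy; apply/seteqP; split => // z.
rewrite /xsection/= inE /underflow_region/= -/v => /and3P[w0 l0].
have : y * log2 v <= 1 by rewrite mulrC -ler_pdivlMr.
move=> {}wy; rewrite leNgt => /negP; apply.
rewrite mulrA; apply: (@le_lt_trans _ _ (1 * log2 (1 + rho * z))).
  by rewrite ler_pM2r.
by rewrite mul1r ltrDr.
Qed.

(** * Underflow probability of two independent exponential variables *)

(* Same device, here for the positivity of the rate. *)
Definition exponential_law (R : realType) (rate : R) (rate0 : 0 < rate) :
    probability (measurableTypeR R) R :=
  exponential_distribution_exponential_prob__canonical__probability_measure_Probability
    rate0.

Lemma exponential_pair_underflow (R : realType) (rho s y : R) :
  0 < rho -> 0 < s -> 0 < y ->
  ((exponential_prob s^-1 \x exponential_prob s^-1) (underflow_region rho y) =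
   (1 / (rho * s))%:E *
     \int[@lebesgue_measure R]_(v in `](2 `^ (1 / y))%R, +oo[)
       (expR (- ((v + v `^ (1 / (y * log2 v - 1)) - 2) / (rho * s))))%:E)%E.
Proof.
move=> rho0 s0 y0; set a := 2 `^ (1 / y).
have sV0 : 0 < s^-1 by rewrite invr_gt0.
have a1 : 1 < a.
  by rewrite /a /powR pnatr_eq0/= expR_gt1 mulr_gt0 ?divr_gt0 ?ln2_gt0.
pose F v := expR (- ((v + v `^ (1 / (y * log2 v - 1)) - 2) / (rho * s))).
pose E := exponential_law sV0.
pose B := underflow_region rho y.
have mB : measurable B by exact: measurable_underflow_region.
(* The tail probability of the second variable given the first, times the density of the first. *)
pose H x := (E (xsection B x) * (exponential_pdf s^-1 x)%:E)%E.
have mpdf := measurable_exponential_pdf s^-1.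
have pdf0 x : 0 <= exponential_pdf s^-1 x.
  by apply: exponential_pdf_ge0; exact: ltW.
have mE : measurable_fun setT (fun x => E (xsection B x)).
  exact: measurable_fun_xsection.
have mH : measurable_fun setT H.
  by apply: emeasurable_funM => //; exact/measurable_EFinP.
have H0 x : (0 <= H x)%E.
  by apply: mule_ge0; [exact: measure_ge0|rewrite lee_fin].
have rhoV0 : 0 < rho^-1 by rewrite invr_gt0.
(* Substitution [v = 1 + rho * x]. The density contributes the exponent [v - 1] and the tail the
   power of [v] minus 1, both over [rho * s] and negated; hence the [- 2]. *)
have HE v : (H (- rho^-1 + rho^-1 * v)%R =
    s^-1%:E * ((EFin \o F) \_ `]a, +oo[%classic) v)%E.
  set x := - rho^-1 + rho^-1 * v.
  have vE : v = 1 + rho * x by rewrite /x; field; rewrite gt_eqF.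
  rewrite /H patchE; have [x0|x0] := ltP x 0.
    (* Negative [x] gives [v <= 1 < a], so the density and the restriction to []a, +oo[] vanish
       together. *)
    rewrite lt0_exponential_pdf// mule0 memNset ?mule0//= in_itv/= andbT.
    by apply/negP; rewrite -leNgt (le_trans _ (ltW a1))// vE gerDl nmulr_lle0// ltW.
  rewrite xsection_underflow_region// -vE exponential_pdfE//.
  have v1 : 1 <= v by rewrite vE lerDl mulr_ge0// ltW.
  have v0 : 0 < v by apply: lt_le_trans v1.
  case: ifPn => av; last first.
    by rewrite measure0 mul0e memNset ?mule0//= in_itv/= andbT; exact/negP.
  rewrite mem_set/=; last by rewrite in_itv/= av.
  have e0 : 0 <= 1 / (y * log2 v - 1).
    by rewrite divr_ge0// subr_ge0 mulrC -ler_pdivrMr// ltW// log2_gt.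
  rewrite -[E _]/(exponential_prob s^-1 _) exponential_prob_itvcy//; last first.
    rewrite divr_ge0 ?(ltW rho0)// subr_ge0 /powR gt_eqF// -[leLHS]expR0 ler_expR.
    by rewrite mulr_ge0// ln_ge0.
  rewrite -!EFinM mulrCA -expRD; congr (_ * expR _)%:E.
  by rewrite vE; field; rewrite !gt_eqF.
(* Measurability of the integrand is inherited from [H] by solving [HE] for it. *)
have mF : measurable_fun setT ((EFin \o F) \_ `]a, +oo[%classic).
  rewrite (_ : _ \_ _ = fun v => (s%:E * H (- rho^-1 + rho^-1 * v)%R)%E).
    apply: measurable_funeM; apply: (measurableT_comp mH).
    by apply: measurable_funD => //; exact: measurable_funM.
  by apply/funext => v; rewrite HE muleA -EFinM divff ?gt_eqF// mul1e.
transitivity (\int[lebesgue_measure]_x H x)%E.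
  rewrite [LHS]/product_measure1.
  apply: (@ge0_integral_density _ _ _ E (@lebesgue_measure R)
    (fun x => (exponential_pdf s^-1 x)%:E)) => //.
    exact/measurable_EFinP.
  by move=> x; exact: (measure_ge0 E).
apply: etrans (ge0_integral_affine (- rho^-1) rhoV0 mH H0) _.
transitivity (rho^-1%:E * \int[lebesgue_measure]_v
    (s^-1%:E * ((EFin \o F) \_ `]a, +oo[%classic) v))%E.
  by congr (_ * _)%E; apply: eq_integral => v _; exact: HE.
rewrite ge0_integralZl//; last 2 first.
- by move=> v _; rewrite patchE; case: ifP => // _; rewrite lee_fin expR_ge0.
- by rewrite lee_fin ltW.
rewrite muleA -EFinM [in RHS]integral_mkcond; congr (_%:E * _)%E.
by rewrite div1r invfM.
Qed.

(** Independence gives the product formula on rectangles, and uniqueness of the product measure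
    extends it to every measurable [Z]. *)
Lemma circular_gaussian_pair (R : realType) (d : measure_display)
    (T : measurableType d) (P : probability T R) (s : R)
    (h1 h2 : {RV P >-> R[i]}) (Z : set (R * R)) :
  0 < s -> circular_gaussian s h1 -> circular_gaussian s h2 ->
  independent_RV h1 h2 -> measurable Z ->
  P ((fun w => (ComplexField.Normc.normc (h1 w) ^+ 2,
                ComplexField.Normc.normc (h2 w) ^+ 2)) @^-1` Z) =
  (exponential_prob s^-1 \x exponential_prob s^-1)%E Z.
Proof.
move=> s0 h1P h2P indep mZ; have sV0 : 0 < s^-1 by rewrite invr_gt0.
pose g (z : R[i]) := ComplexField.Normc.normc z ^+ 2.
have mg : measurable_fun setT (g : _ -> measurableTypeR R).
  exact: measurable_sqr_normc.
have mf : measurable_fun setT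
    (fun w => (g (h1 w), g (h2 w)) : measurableTypeR R * measurableTypeR R).
  by apply/measurable_fun_pair; apply: (measurableT_comp mg).
apply: esym; apply: (@product_measure_unique _ _ _ _ _ (exponential_law sV0)
  (exponential_law sV0) (pushforward_measure P mf)) => // A B mA mB.
have mgV C : measurable C -> measurable (g @^-1` C).
  by move=> mC; rewrite -[X in measurable X]setTI; exact: mg.
apply: etrans (indep _ _ (mgV _ mA) (mgV _ mB)) _.
by congr (_ * _)%E; apply: circular_gaussian_sqr_normc.
Qed.

(** * Corners inside and around the underflow region, and the conclusion *)

Lemma exponential_prob2_corner (R : realType) (s a : R) :
  0 < s -> 0 <= a ->
  ((exponential_prob s^-1 \x exponential_prob s^-1)
     (`[a, +oo[ `*` `[a, +oo[) = (expR (- (2 * (a / s))))%:E)%E.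
Proof.
move=> s0 a0; have sV0 : 0 < s^-1 by rewrite invr_gt0.
transitivity (exponential_prob s^-1 `[a, +oo[ *
    exponential_prob s^-1 `[a, +oo[)%E.
  exact: (product_measure1E (exponential_law sV0) (exponential_law sV0)
    (measurable_itv _) (measurable_itv _)).
rewrite exponential_prob_itvcy// -EFinM -expRD; congr (expR _)%:E; ring.
Qed.

Lemma corner_sub_underflow_region (R : realType) (rho y : R) :
  0 < rho -> 0 < y ->
  `[(2 `^ (2 / y) - 1) / rho, +oo[ `*` `[(2 `^ (2 / y) - 1) / rho, +oo[
    `<=` underflow_region rho y.
Proof.
move=> rho0 y0 [a b]; rewrite /underflow_region/= !in_itv/= !andbT.
have t0 : 0 < 2 / y by rewrite divr_gt0.
rewrite !ler_pdivrMr// !lerBlDl ![_ * rho]mulrC -!log2_ge// => -[ua vb].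
rewrite (lt_le_trans t0 ua) (lt_le_trans t0 vb)/=.
(* From [2 <= u * y] and [2 <= v * y], half of [y * u * v] is at least [v] and the other half at
   least [u]. *)
move: ua vb; rewrite !ler_pdivrMr//; nra.
Qed.

Lemma underflow_region_sub_corner (R : realType) (rho y : R) :
  0 < rho -> 0 < y ->
  underflow_region rho y `<=`
  `[(2 `^ (1 / y) - 1) / rho, +oo[ `*` `[(2 `^ (1 / y) - 1) / rho, +oo[.
Proof.
move=> rho0 y0 [a b]; rewrite /underflow_region/= !in_itv/= !andbT.
have t0 : 0 < 1 / y by rewrite divr_gt0.
rewrite !ler_pdivrMr// !lerBlDl ![_ * rho]mulrC -!log2_ge// => /and3P[u0 v0 uv].
rewrite !ler_pdivrMr//.
set u := log2 _ in u0 uv *; set v := log2 _ in v0 uv *.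
split.
(* Multiplied by [v], the goal [1 <= u * y] becomes [v <= y * u * v], which follows from [uv] by
   dropping the positive [u]. *)
- rewrite -(ler_pM2r v0); lra.
- rewrite -(ler_pM2r u0); lra.
Qed.

Unset Implicit Arguments.
Set Strict Implicit.

Theorem proposition3 (R : realType) (d : measure_display)
    (T : measurableType d) (P : probability T R)
    (rho : R) (L : nat) (sigmaE2 y : R) (h1 h2 : {RV P >-> R[i]}) :
  0 < rho -> (1 <= L)%N -> sigmaE2 = 1 / (1 + rho * L%:R) -> 0 < y ->
  circular_gaussian (1 - sigmaE2) h1 ->
  circular_gaussian (1 - sigmaE2) h2 ->
  independent_RV h1 h2 ->
  let underflow : set T :=
    [set w | (bit_time rho (h1 w) + bit_time rho (h2 w) <= y%:E)%E] in
  [/\ P underflow =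
        ((1 / (rho * (1 - sigmaE2)))%:E *
         \int[@lebesgue_measure R]_(v in `](2 `^ (1 / y))%R, +oo[)
           (expR (- ((v + v `^ (1 / (y * log2 v - 1)) - 2)
                     / (rho * (1 - sigmaE2)))))%:E)%E,
      ((expR (- (2 * ((2 `^ (2 / y) - 1) / (rho * (1 - sigmaE2))))))%:E
         <= P underflow)%E
    & (P underflow
         <= (expR (- (2 * ((2 `^ (1 / y) - 1) / (rho * (1 - sigmaE2))))))%:E)%E].
Proof.
move=> rho0 L1 sigmaE y0 h1P h2P indep underflow.
set s := 1 - sigmaE2 in h1P h2P *.
(* At least one pilot makes [1 + rho * L > 1], so the estimate has positive variance, as the
   exponential law requires. *)
have s0 : 0 < s.
  rewrite /s sigmaE subr_gt0 ltr_pdivrMr ?mul1r ?ltrDl ?addr_gt0// mulr_gt0//;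
    by rewrite ltr0n.
have sV0 : 0 < s^-1 by rewrite invr_gt0.
pose E2 := (exponential_law sV0 \x exponential_law sV0)%E.
have mB := measurable_underflow_region rho y.
have PE : P underflow = E2 (underflow_region rho y).
  apply: etrans (circular_gaussian_pair s0 h1P h2P indep mB).
  congr (P _); apply/seteqP.
  (* Nonnegative rates are what [inve_sum_le] asks for to turn the sum of bit times into the
     region. *)
  have log0 z : 0 <= log2 (1 + rho * ComplexField.Normc.normc z ^+ 2).
    by rewrite log2_ge0// lerDl mulr_ge0 ?sqr_ge0// ltW.
  by split => w; rewrite /underflow /bit_time /underflow_region/= inve_sum_le.
have corner0 t : 0 < t -> 0 <= (2 `^ t - 1) / rho.
  move=> t0; rewrite divr_ge0 ?(ltW rho0)// subr_ge0 /powR pnatr_eq0/=.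
  by rewrite -[leLHS]expR0 ler_expR mulr_ge0 ?ltW ?ln2_gt0.
have cornerE t : 0 < t ->
    E2 (`[(2 `^ t - 1) / rho, +oo[ `*` `[(2 `^ t - 1) / rho, +oo[) =
    (expR (- (2 * ((2 `^ t - 1) / (rho * s)))))%:E.
  move=> t0; apply: etrans (exponential_prob2_corner s0 (corner0 _ t0)) _.
  by congr (expR (- (2 * _)))%:E; rewrite invfM mulrA.
have mcorner (a : R) : measurable (`[a, +oo[ `*` `[a, +oo[ : set (R * R)).
  by apply: measurableX; exact: measurable_itv.
have leE2 (A B : set (R * R)) : measurable A -> measurable B ->
    A `<=` B -> (E2 A <= E2 B)%E.
  by move=> mA mB' AB; apply: le_measure => //; apply/mem_set.
have t1 : 0 < 1 / y by rewrite divr_gt0.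
have t2 : 0 < 2 / y by rewrite divr_gt0.
rewrite PE -(cornerE _ t1) -(cornerE _ t2); split.
- exact: exponential_pair_underflow.
- apply: leE2; [exact: mcorner|exact: mB|exact: corner_sub_underflow_region].
- apply: leE2; [exact: mB|exact: mcorner|exact: underflow_region_sub_corner].
Qed.
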